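(* Let $\alpha_V\in[0,1]$. Choose the midpoint rule for the fast potential and the trapezoidal rule for the slow potential: $$V_d(q_k^s,q_{k+1}^s,q_k^f)=\sum_{m=0}^{p-1}\Delta t\big(\alpha_VV(q_k^{s,m},q_k^{f,m})+(1-\alpha_V)V(q_k^{s,m+1},q_k^{f,m+1})\big),\qquad W_d(q_k^f)=\sum_{m=0}^{p-1}\Delta t\,W(\bar q_k^{f,m}),$$ where $\bar q_k^{f,m}=\tfrac12(q_k^{f,m}+q_k^{f,m+1})$. Then the momentum form of the discrete multirate Euler-Lagrange equations is equivalent to the following $(p,q)$-scheme (for $k=0,\dots,N-1$ and $m=0,\dots,p-1$), with slow part $$q_{k+1}^s=q_k^s+\Delta T(M^s)^{-1}\Big[p_k^s-\Delta t\Big(\sum_{m=1}^{p-1}\frac{p-m}{p}\frac{\partial V}{\partial q^s}(q_k^{s,m},q_k^{f,m})+\alpha_V\frac{\partial V}{\partial q^s}(q_k^{s,0},q_k^{f,0})\Big)\Big],$$ $$p_{k+1}^s=p_k^s-\Delta t\Big(\sum_{m=1}^{p-1}\frac{\partial V}{\partial q^s}(q_k^{s,m},q_k^{f,m})+\alpha_V\frac{\partial V}{\partial q^s}(q_k^{s,0},q_k^{f,0})+(1-\alpha_V)\frac{\partial V}{\partial q^s}(q_k^{s,p},q_k^{f,p})\Big)$$ and fast part (kick-oscillate-kick) $$\tilde p_k^{f,m}=p_k^{f,m}-\alpha_V\Delta t\frac{\partial V}{\partial q^f}(q_k^{s,m},q_k^{f,m}),$$ $$q_k^{f,m+1}=q_k^{f,m}+\Delta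 t(M^f)^{-1}\frac{\tilde p_k^{f,m}+\hat p_k^{f,m+1}}{2},\qquad \hat p_k^{f,m+1}=\tilde p_k^{f,m}-\Delta t\,\nabla W(\bar q_k^{f,m}),$$ $$p_k^{f,m+1}=\hat p_k^{f,m+1}-(1-\alpha_V)\Delta t\frac{\partial V}{\partial q^f}(q_k^{s,m+1},q_k^{f,m+1}).$$ Equivalently, it can be written as the transformed $(p,q)$-scheme, with the same fast part and with the slow part replaced by $$\tilde p_k^s=p_k^s-\Delta t\Big(\sum_{m=1}^{p-1}\frac{p-m}{p}\frac{\partial V}{\partial q^s}(q_k^{s,m},q_k^{f,m})+\alpha_V\frac{\partial V}{\partial q^s}(q_k^{s,0},q_k^{f,0})\Big),$$ $$q_{k+1}^s=q_k^s+\Delta T(M^s)^{-1}\tilde p_k^s,$$ $$p_{k+1}^s=\tilde p_k^s-\Delta t\Big(\sum_{m=1}^{p-1}\frac{m}{p}\frac{\partial V}{\partial q^s}(q_k^{s,m},q_k^{f,m})+(1-\alpha_V)\frac{\partial V}{\partial q^s}(q_k^{s,p},q_k^{f,p})\Big).$$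
   Context: Let $Q=Q^s\times Q^f\subset\mathbb{R}^{n^s}\times\mathbb{R}^{n^f}$ be open, with slow variables $q^s$ and fast variables $q^f$. The multirate Lagrangian is $L=\tfrac12(\dot q^s)^TM^s\dot q^s+\tfrac12(\dot q^f)^TM^f\dot q^f-V(q^s,q^f)-W(q^f)$, with symmetric invertible mass matrices $M^s,M^f$ (so $L$ is regular), smooth slow potential $V$ and smooth fast potential $W$. Let $\Delta T=p\,\Delta t$, where $p\in\mathbb{N}$ (without indices) is the number of micro steps per macro step; indexed symbols $p_k^s,\ p_k^{f,m}$ denote momenta. Discrete slow configurations $q_k^s$, $k=0,\dots,N$, live on macro nodes $k\Delta T$; discrete fast configurations $q_k^{f,m}$, $k=0,\dots,N-1$, $m=0,\dots,p$, live on micro nodes $k\Delta T+m\Delta t$, with $q_{k-1}^{f,p}=q_k^{f,0}$; $q_k^f=(q_k^{f,0},\dots,q_k^{f,p})$. The slow values at micro nodes are linearly interpolated: $q_k^{s,m}=q_k^s+\tfrac{m}{p}(q_{k+1}^s-q_k^s)$, $m=0,\dots,p$. The discrete Lagrangian is $L_d=T_d-V_d-W_d$ with $$T_d=\frac{\Delta T}{2}\Big(\frac{q_{k+1}^s-q_k^s}{\Delta T}\Big)^TM^s\Big(\frac{q_{k+1}^s-q_k^s}{\Delta T}\Big)+\sum_{m=0}^{p-1}\frac{\Delta t}{2}\Big(\frac{q_k^{f,m+1}-q_k^{f,m}}{\Delta t}\Big)^TM^f\Big(\frac{q_k^{f,m+1}-q_k^{f,m}}{\Delta t}\Big).$$ It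 is written as $L_d(q_k^s,q_{k+1}^s,q_k^f)=\sum_{m=0}^{p-1}L_d^m(q_k^s,q_{k+1}^s,q_k^{f,m},q_k^{f,m+1})$, where $L_d^m$ collects the contributions of the $m$-th micro interval. The discrete multirate Euler-Lagrange equations (stationarity of $\sum_kL_d(q_k^s,q_{k+1}^s,q_k^f)$ with fixed end points) express matching of left and right discrete momenta at all macro and micro nodes. Their momentum form, with unique momenta $p_k^s$ and $p_k^{f,m}$ and $p_{k-1}^{f,p}=p_k^{f,0}$, is: for $k=0,\dots,N-1$ and $m=0,\dots,p-1$, $$p_k^s=-D_{q_k^s}L_d(q_k^s,q_{k+1}^s,q_k^f),\qquad p_{k+1}^s=D_{q_{k+1}^s}L_d(q_k^s,q_{k+1}^s,q_k^f),$$ $$p_k^{f,m}=-D_{q_k^{f,m}}L_d^m(q_k^s,q_{k+1}^s,q_k^{f,m},q_k^{f,m+1}),\qquad p_k^{f,m+1}=D_{q_k^{f,m+1}}L_d^m(q_k^s,q_{k+1}^s,q_k^{f,m},q_k^{f,m+1}),$$ where $D_*$ is the partial derivative with respect to the argument $*$ (written as a column vector). *)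

(* Defs.v *)
From HB Require Import structures.
From mathcomp Require Import all_boot all_order all_algebra.
From mathcomp Require Import all_classical all_reals all_analysis.
From mathcomp Require Import ring.

Set Implicit Arguments.
Unset Strict Implicit.
Unset Printing Implicit Defensive.

Import Order.TTheory GRing.Theory Num.Theory.
Import numFieldNormedType.Exports.

Local Open Scope classical_set_scope.
Local Open Scope ring_scope.

(* Meant for open [A] in finite dimension, where it is the usual notion: then
   [f] is C^(k+1) iff it is differentiable and each ['D_v f] is C^k.          *)
Fixpoint Ck_on {R : realType} {U V : normedModType R} (A : set U) (k : nat)
    (f : U -> V) : Prop :=
  if k is k'.+1 then
    (forall x, A x -> differentiable f x) /\ (forall v, Ck_on A k' ('D_v f))
  else forall x, A x -> {for x, continuous f}.

Definition smooth_on {R : realType} {U V : normedModType R} (A : set U)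
  (f : U -> V) : Prop := forall k, Ck_on A k f.

Definition grad {R : realType} {n : nat} (f : 'cV[R]_n -> R) (x : 'cV[R]_n) :
  'cV[R]_n := \col_i 'D_(delta_mx i ord0) f x.

Definition quad {R : realType} {n : nat} (M : 'M[R]_n) (v : 'cV[R]_n) : R :=
  (v^T *m M *m v) ord0 ord0.

Section Multirate.
Context {R : realType} {ns nf : nat}.
Context (p : nat) (dt alphaV : R).
Context (Ms : 'M[R]_ns) (Mf : 'M[R]_nf).
Context (V : 'cV[R]_ns * 'cV[R]_nf -> R) (W : 'cV[R]_nf -> R).

Definition dV_s (x : 'cV[R]_ns) (y : 'cV[R]_nf) : 'cV[R]_ns :=
  grad (fun x' => V (x', y)) x.
Definition dV_f (x : 'cV[R]_ns) (y : 'cV[R]_nf) : 'cV[R]_nf :=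
  grad (fun y' => V (x, y')) y.

Definition macro_step : R := p%:R * dt.

Definition slow_interp (x0 x1 : 'cV[R]_ns) (m : nat) : 'cV[R]_ns :=
  x0 + (m%:R / p%:R) *: (x1 - x0).

Definition midpoint (y0 y1 : 'cV[R]_nf) : 'cV[R]_nf := 2^-1 *: (y0 + y1).

(* [y : nat -> 'cV_nf] stands for the tuple (q_k^{f,0}, ..., q_k^{f,p}); only
   its values at 0, ..., p are used.                                          *)
Definition T_d (x0 x1 : 'cV[R]_ns) (y : nat -> 'cV[R]_nf) : R :=
  macro_step / 2 * quad Ms (macro_step^-1 *: (x1 - x0))
  + \sum_(0 <= m < p) dt / 2 * quad Mf (dt^-1 *: (y m.+1 - y m)).

Definition V_d (x0 x1 : 'cV[R]_ns) (y : nat -> 'cV[R]_nf) : R :=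
  \sum_(0 <= m < p)
     dt * (alphaV * V (slow_interp x0 x1 m, y m)
           + (1 - alphaV) * V (slow_interp x0 x1 m.+1, y m.+1)).

Definition W_d (y : nat -> 'cV[R]_nf) : R :=
  \sum_(0 <= m < p) dt * W (midpoint (y m) (y m.+1)).

Definition L_d (x0 x1 : 'cV[R]_ns) (y : nat -> 'cV[R]_nf) : R :=
  T_d x0 x1 y - V_d x0 x1 y - W_d y.

(* Each of the p micro intervals carries a share dt / 2 of the factor
   macro_step / 2 of the slow kinetic energy.                                 *)
Definition L_dm (m : nat) (x0 x1 : 'cV[R]_ns) (y0 y1 : 'cV[R]_nf) : R :=
  dt / 2 * quad Ms (macro_step^-1 *: (x1 - x0))
  + dt / 2 * quad Mf (dt^-1 *: (y1 - y0))
  - dt * (alphaV * V (slow_interp x0 x1 m, y0)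
          + (1 - alphaV) * V (slow_interp x0 x1 m.+1, y1))
  - dt * W (midpoint y0 y1).

Lemma L_d_sum x0 x1 y :
  L_d x0 x1 y = \sum_(0 <= m < p) L_dm m x0 x1 (y m) (y m.+1).
Proof.
rewrite /L_d /T_d /V_d /W_d /L_dm !sumrB big_split /=.
congr (_ + _ - _ - _).
by rewrite sumr_const_nat subn0 -mulr_natl /macro_step; ring.
Qed.

(* Trajectories: [qs k], [ps k] for k <= N; [qf k m], [pf k m] for k < N and
   m <= p.  No other values are used below.                                   *)

Definition momentum_form (N : nat) (qs : nat -> 'cV[R]_ns)
    (qf : nat -> nat -> 'cV[R]_nf) (ps : nat -> 'cV[R]_ns)
    (pf : nat -> nat -> 'cV[R]_nf) : Prop :=
  forall k, (k < N)%N ->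
  [/\ ps k = - grad (fun x => L_d x (qs k.+1) (qf k)) (qs k),
      ps k.+1 = grad (fun x => L_d (qs k) x (qf k)) (qs k.+1)
    & forall m, (m < p)%N ->
      pf k m = - grad (fun y => L_dm m (qs k) (qs k.+1) y (qf k m.+1)) (qf k m)
      /\ pf k m.+1
           = grad (fun y => L_dm m (qs k) (qs k.+1) (qf k m) y) (qf k m.+1)].

Definition slow_part (N : nat) (qs : nat -> 'cV[R]_ns)
    (qf : nat -> nat -> 'cV[R]_nf) (ps : nat -> 'cV[R]_ns) : Prop :=
  forall k, (k < N)%N ->
  let qsm := slow_interp (qs k) (qs k.+1) in
  qs k.+1 = qs k + macro_step *: (invmx Ms *m
    (ps k - dt *: (\sum_(1 <= m < p)
                     ((p - m)%:R / p%:R) *: dV_s (qsm m) (qf k m)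
                   + alphaV *: dV_s (qsm 0%N) (qf k 0%N))))
  /\ ps k.+1 = ps k - dt *: (\sum_(1 <= m < p) dV_s (qsm m) (qf k m)
                             + alphaV *: dV_s (qsm 0%N) (qf k 0%N)
                             + (1 - alphaV) *: dV_s (qsm p) (qf k p)).

Definition fast_part (N : nat) (qs : nat -> 'cV[R]_ns)
    (qf : nat -> nat -> 'cV[R]_nf) (pf : nat -> nat -> 'cV[R]_nf) : Prop :=
  exists pft pfh : nat -> nat -> 'cV[R]_nf,
  forall k m, (k < N)%N -> (m < p)%N ->
  let qsm := slow_interp (qs k) (qs k.+1) in
  [/\ pft k m = pf k m - (alphaV * dt) *: dV_f (qsm m) (qf k m),
      qf k m.+1 = qf k m + dt *: (invmx Mf *m
                                    (2^-1 *: (pft k m + pfh k m.+1))),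
      pfh k m.+1 = pft k m - dt *: grad W (midpoint (qf k m) (qf k m.+1))
    & pf k m.+1 = pfh k m.+1
                  - ((1 - alphaV) * dt) *: dV_f (qsm m.+1) (qf k m.+1)].

Definition transformed_slow_part (N : nat) (qs : nat -> 'cV[R]_ns)
    (qf : nat -> nat -> 'cV[R]_nf) (ps : nat -> 'cV[R]_ns) : Prop :=
  exists pst : nat -> 'cV[R]_ns,
  forall k, (k < N)%N ->
  let qsm := slow_interp (qs k) (qs k.+1) in
  [/\ pst k = ps k - dt *: (\sum_(1 <= m < p)
                              ((p - m)%:R / p%:R) *: dV_s (qsm m) (qf k m)
                            + alphaV *: dV_s (qsm 0%N) (qf k 0%N)),
      qs k.+1 = qs k + macro_step *: (invmx Ms *m pst k)
    & ps k.+1 = pst k - dt *: (\sum_(1 <= m < p)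
                                 (m%:R / p%:R) *: dV_s (qsm m) (qf k m)
                               + (1 - alphaV) *: dV_s (qsm p) (qf k p))].

Definition pq_scheme N qs qf ps pf : Prop :=
  slow_part N qs qf ps /\ fast_part N qs qf pf.

Definition transformed_pq_scheme N qs qf ps pf : Prop :=
  transformed_slow_part N qs qf ps /\ fast_part N qs qf pf.

(* All points at which V or W is evaluated lie in its domain; this does not
   follow from the nodes alone, as [Qs] and [Qf] need not be convex.          *)
Definition nodes_in (Qs : set 'cV[R]_ns) (Qf : set 'cV[R]_nf) (N : nat)
    (qs : nat -> 'cV[R]_ns) (qf : nat -> nat -> 'cV[R]_nf) : Prop :=
  forall k, (k < N)%N ->
  (forall m, (m <= p)%N ->
     Qs (slow_interp (qs k) (qs k.+1) m) /\ Qf (qf k m))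
  /\ (forall m, (m < p)%N -> Qf (midpoint (qf k m) (qf k m.+1))).

(* The last micro node of a macro interval is the first one of the next.      *)
Definition glued (N : nat) (u : nat -> nat -> 'cV[R]_nf) : Prop :=
  forall k, (k.+1 < N)%N -> u k p = u k.+1 0%N.

End Multirate.

(* Main.v *)
(** Each momentum equation is a gradient of the discrete Lagrangian. The
    gradient of the quadratic kinetic term is +-c^-1 M (q' - q), with c the step
    size, so for invertible M the left momentum equation can be solved for the
    new position q'; substituting it into the right momentum equation eliminates
    the velocity and leaves a pure sum of forces.
    In the slow equations the chain rule through the linear interpolation puts
    weights (p - m)/p (left) and m/p (right) on the force at micro node m; the
    trapezoidal sums then collapse to interior nodes plus end points, and the two
    weights add up to 1. In the fast equations each side receives half of the
    midpoint force dt grad W, which makes the new position an average of the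
    momenta before and after the oscillation step. *)
Require Import Defs.
From mathcomp Require Import all_boot all_order all_algebra.
From mathcomp Require Import all_classical all_reals all_analysis.
From mathcomp Require Import ring.

Set Implicit Arguments.
Unset Strict Implicit.
Unset Printing Implicit Defensive.

Import Order.TTheory GRing.Theory Num.Theory.
Import numFieldNormedType.Exports.

Local Open Scope classical_set_scope.
Local Open Scope ring_scope.

(** [grad] has a value even where partial derivatives fail to exist; this relation also records
    their existence, which the calculus rules require. *)
Definition is_grad {R : realType} {n : nat} (f : 'cV[R]_n -> R)
    (x g : 'cV[R]_n) : Prop :=
  forall i, is_derive x (delta_mx i ord0) f (g i ord0).

Section IsGrad.
Context {R : realType} {n : nat}.
Implicit Types (f g : 'cV[R]_n -> R) (x u w : 'cV[R]_n).

Lemma grad_is_grad f x u : is_grad f x u -> grad f x = u.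
Proof.
by move=> fx; apply/colP => i; rewrite mxE; have ? := fx i; rewrite derive_val.
Qed.

Lemma is_grad_cst (a : R) x : is_grad (cst a) x 0.
Proof. by move=> i; rewrite mxE; exact: is_derive_cst. Qed.

Lemma is_gradD f g x u w :
  is_grad f x u -> is_grad g x w -> is_grad (f \+ g) x (u + w).
Proof.
by move=> fx gx i; rewrite mxE; apply: is_deriveD; [exact: fx|exact: gx].
Qed.

Lemma is_gradB f g x u w :
  is_grad f x u -> is_grad g x w -> is_grad (f \- g) x (u - w).
Proof.
by move=> fx gx i; rewrite !mxE; apply: is_deriveB; [exact: fx|exact: gx].
Qed.

Lemma is_gradZ (a : R) f x u :
  is_grad f x u -> is_grad (fun z => a * f z) x (a *: u).
Proof. by move=> fx i; rewrite !mxE; apply: is_deriveZ; exact: fx. Qed.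

Lemma is_grad_sum (p : nat) (F : nat -> 'cV[R]_n -> R) x (u : nat -> 'cV[R]_n) :
  (forall m, (m < p)%N -> is_grad (F m) x (u m)) ->
  is_grad (fun z => \sum_(0 <= m < p) F m z) x (\sum_(0 <= m < p) u m).
Proof.
elim: p => [|p IHp] Fx.
  rewrite big_geq //; under eq_fun do rewrite big_geq //.
  exact: is_grad_cst.
rewrite big_nat_recr //=; under eq_fun do rewrite big_nat_recr //=.
apply: is_gradD; last exact: Fx.
by apply: IHp => m mp; apply: Fx; rewrite ltnW.
Qed.

End IsGrad.

(** * Chain rule along affine maps; gradient of a quadratic form *)

Section DirectionalDerivative.
Context {R : realType}.

(** Affinity makes both difference quotients the same function of [h], so existence and value of the
    limit carry over together. *)
Lemma is_derive_affine (U U' : normedModType R) (A : U -> U') (f : U' -> R)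
    (x v : U) (v' : U') (df : R) :
  (forall h : R, A (h *: v + x) = h *: v' + A x) ->
  is_derive (A x) v' f df -> is_derive x v (f \o A) df.
Proof.
move=> Av [fd fE].
have E : (fun h : R => h^-1 *: (((f \o A) \o shift x) (h *: v) - (f \o A) x))
       = (fun h : R => h^-1 *: ((f \o shift (A x)) (h *: v') - f (A x))).
  by apply/funext => h /=; rewrite Av.
by split; rewrite /derivable /derive E.
Qed.

(** [c] is a slope and [j] turns directions into those of [U], for instance by embedding a factor
    into a product. Differentiability makes ['D] linear in the direction, so [c] comes out. *)
Lemma is_grad_affine (U : normedModType R) (n : nat) (A : 'cV[R]_n -> U)
    (j : 'cV[R]_n -> U) (c : R) (f : U -> R) (x : 'cV[R]_n) :
  (forall (h : R) v, A (h *: v + x) = h *: (c *: j v) + A x) ->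
  differentiable f (A x) ->
  is_grad (f \o A) x (c *: \col_i 'D_(j (delta_mx i ord0)) f (A x)).
Proof.
move=> AE fA i; rewrite !mxE.
apply: (is_derive_affine (v' := c *: j (delta_mx i ord0))) => //.
split; first exact: diff_derivable.
by rewrite !deriveE // linearZ.
Qed.

(** Symmetry of [M] merges the two mixed terms, a 1 x 1 matrix being its own transpose. *)
Lemma quadD_scale (n : nat) (M : 'M[R]_n) (h : R) (x v : 'cV[R]_n) :
  M^T = M ->
  quad M (h *: v + x)
  = quad M x + h * (2 * (v^T *m (M *m x)) ord0 ord0) + h ^+ 2 * quad M v.
Proof.
move=> symM.
have xMv : x^T *m M *m v = v^T *m M *m x.
  rewrite [LHS]mx11_scalar -[LHS]tr_scalar_mx -mx11_scalar.
  by rewrite !trmx_mul trmxK symM mulmxA.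
rewrite /quad [(_ + _)^T]linearD /= [(_ *: _)^T]linearZ /=.
rewrite !(mulmxDl, mulmxDr).
rewrite -!(scalemxAl, scalemxAr) xMv mulmxA.
move: (v^T *m M *m x) (v^T *m M *m v) (x^T *m M *m x) => a b c.
rewrite !mxE; ring.
Qed.

Lemma is_derive_quad (n : nat) (M : 'M[R]_n) (x v : 'cV[R]_n) :
  M^T = M -> is_derive x v (quad M) (2 * (v^T *m (M *m x)) ord0 ord0).
Proof.
move=> symM; set d := 2 * _.
have E : (fun h : R => h^-1 *: ((quad M \o shift x) (h *: v) - quad M x))
   @ 0^' --> d.
  (* By [quadD_scale] the quotient is affine in [h] away from 0. *)
  apply: cvg_trans (_ : (fun h : R => d + h * quad M v) @ 0^' --> d).
    apply: near_eq_cvg; near=> h => /=.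
    have h0 : h != 0 by near: h; exact: nbhs_dnbhs_neq.
    rewrite quadD_scale // -/d /GRing.scale /=; field.
    exact: h0.
  apply: cvg_within_filter.
  have : (fun h : R => d + h * quad M v) @ 0 --> d + 0 * quad M v.
    by apply: cvgD; [exact: cvg_cst|apply: cvgMr_tmp; exact: cvg_id].
  by rewrite mul0r addr0.
split; first by apply/cvg_ex; exists d; exact: E.
exact/cvg_lim.
Unshelve. all: by end_near.
Qed.

Lemma is_grad_quad_affine (n : nat) (M : 'M[R]_n) (c : R)
    (A : 'cV[R]_n -> 'cV[R]_n) (x : 'cV[R]_n) :
  M^T = M -> (forall (h : R) v, A (h *: v + x) = h *: (c *: v) + A x) ->
  is_grad (fun z => quad M (A z)) x ((2 * c) *: (M *m A x)).
Proof.
move=> symM AE i.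
apply: (is_derive_affine (v' := c *: delta_mx i ord0)) => //.
apply: is_derive_eq; first exact: is_derive_quad.
rewrite linearZ /= trmx_delta -scalemxAl -rowE !mxE.
ring.
Qed.

End DirectionalDerivative.

(** * Summation identities and the discrete Legendre transform *)

Section Algebra.
Context {R : realType}.

(** An interior node is the right end of one interval and the left end of the next, so its weights
    [1 - a] and [a] add up to 1. *)
Lemma sum_trapezoid (E : lmodType R) (p : nat) (a : R) (G : nat -> E) :
  (0 < p)%N ->
  \sum_(0 <= m < p) (a *: G m + (1 - a) *: G m.+1)
  = \sum_(1 <= m < p) G m + a *: G 0%N + (1 - a) *: G p.
Proof.
case: p => // p _; rewrite big_split /= -!scaler_sumr big_add1 /=.
rewrite (big_nat_recl _ _ G) // (big_nat_recr _ _ (fun m => G m.+1)) //=.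
rewrite !scalerDr addrA; congr (_ + _).
by rewrite -addrA -scalerDl [a + _]addrC subrK scale1r addrC.
Qed.

Lemma legendre_step (n : nat) (M : 'M[R]_n) (c : R) (x0 x1 z : 'cV[R]_n) :
  M \in unitmx -> c != 0 ->
  z = c^-1 *: (M *m (x1 - x0)) <-> x1 = x0 + c *: (invmx M *m z).
Proof.
move=> unitM c0; split=> [->|->].
  by rewrite -scalemxAr mulKmx // scalerA divff // scale1r addrC subrK.
by rewrite addrAC subrr add0r -scalemxAr mulKVmx // scalerA mulVf // scale1r.
Qed.

Lemma sum_complementary_weights (E : lmodType R) (p : nat) (G : nat -> E) :
  \sum_(1 <= m < p) ((p - m)%:R / p%:R : R) *: G m
  + \sum_(1 <= m < p) (m%:R / p%:R : R) *: G m = \sum_(1 <= m < p) G m.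
Proof.
rewrite -big_split /=; apply: eq_big_nat => m /andP[m0 mp].
rewrite -scalerDl -mulrDl -natrD subnK ?(ltnW mp) // divff ?scale1r //.
by rewrite pnatr_eq0 -lt0n (leq_ltn_trans _ mp).
Qed.

End Algebra.

(** * Gradients of the discrete Lagrangian *)

Section DiscreteLagrangian.
Context {R : realType} {ns nf : nat}.
Context (Qs : set 'cV[R]_ns) (Qf : set 'cV[R]_nf).
Context (Ms : 'M[R]_ns) (Mf : 'M[R]_nf).
Context (V : 'cV[R]_ns * 'cV[R]_nf -> R) (W : 'cV[R]_nf -> R).
Context (p : nat) (dt a : R).
Hypotheses (sym_Ms : Ms^T = Ms) (sym_Mf : Mf^T = Mf).
Hypotheses (smooth_V : smooth_on (Qs `*` Qf) V) (smooth_W : smooth_on Qf W).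
Hypotheses (p_gt0 : (0 < p)%N) (dt_gt0 : 0 < dt).

Local Notation DT := (macro_step p dt).
Local Notation interp := (slow_interp p).
Local Notation Lm := (L_dm p dt a Ms Mf V W).
Local Notation L := (L_d p dt a Ms Mf V W).

Implicit Types (x : 'cV[R]_ns) (y : 'cV[R]_nf) (q : nat -> 'cV[R]_nf).

Lemma smooth_on_differentiable (E : normedModType R) (D : set E) (f : E -> R) z :
  smooth_on D f -> D z -> differentiable f z.
Proof. by move=> /(_ 1%N)[df _]; exact: df. Qed.

Lemma pR_neq0 : p%:R != 0 :> R.
Proof. by rewrite pnatr_eq0 -lt0n. Qed.

Lemma dt_neq0 : dt != 0.
Proof. by rewrite gt_eqF. Qed.

Lemma macro_step_neq0 : DT != 0.
Proof. by rewrite mulf_neq0 ?pR_neq0 ?dt_neq0. Qed.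

Lemma is_grad_V_slow (A : 'cV[R]_ns -> 'cV[R]_ns) (c : R) x y :
  (forall (h : R) v, A (h *: v + x) = h *: (c *: v) + A x) ->
  Qs (A x) -> Qf y ->
  is_grad (fun z => V (A z, y)) x (c *: dV_s V (A x) y).
Proof.
move=> AE QA Qy.
have dV : differentiable V (A x, y).
  exact: (smooth_on_differentiable smooth_V).
(* [dV_s] differentiates a partial function; [is_grad_affine] yields derivatives of [V] on the
   product, along [(delta_mx i ord0, 0)]. *)
have -> : dV_s V (A x) y = \col_i 'D_(delta_mx i ord0, 0) V (A x, y).
  apply: grad_is_grad => i; rewrite mxE.
  apply: (is_derive_affine (A := fun z => (z, y)) (v' := (delta_mx i ord0, 0))).
    by move=> h; congr (_, _); rewrite /= scaler0 add0r.
  exact/derivableP/diff_derivable.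
apply: (is_grad_affine (A := fun z => (A z, y)) (j := fun v => (v, 0))) => //.
by move=> h v; congr (_, _); rewrite /= ?AE // !scaler0 add0r.
Qed.

Lemma is_grad_V_fast x y :
  Qs x -> Qf y -> is_grad (fun z => V (x, z)) y (dV_f V x y).
Proof.
move=> Qx Qy.
have dV : differentiable V (x, y).
  exact: (smooth_on_differentiable smooth_V).
have gV : is_grad (fun z => V (x, z)) y
                  (1 *: \col_i 'D_(0, delta_mx i ord0) V (x, y)).
  apply: (is_grad_affine (A := fun z => (x, z)) (j := fun v => (0, v))) => //.
  by move=> h v; congr (_, _); rewrite /= ?scale1r // !scaler0 add0r.
by rewrite /dV_f (grad_is_grad gV).
Qed.

Lemma is_grad_W (A : 'cV[R]_nf -> 'cV[R]_nf) (c : R) y :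
  (forall (h : R) v, A (h *: v + y) = h *: (c *: v) + A y) -> Qf (A y) ->
  is_grad (fun z => W (A z)) y (c *: grad W (A y)).
Proof.
move=> AE QA; apply: (is_grad_affine (j := id)) => //.
exact: (smooth_on_differentiable smooth_W).
Qed.

(** With [w m] the slope of the interpolation at node [m] in the slow argument being varied, this is
    the gradient of [V_d] divided by [dt]. *)
Definition slow_weighted_force (w : nat -> R) x0 x1 q : 'cV[R]_ns :=
  \sum_(0 <= m < p) (a *: (w m *: dV_s V (interp x0 x1 m) (q m))
    + (1 - a) *: (w m.+1 *: dV_s V (interp x0 x1 m.+1) (q m.+1))).

Lemma slow_weighted_forceE (w : nat -> R) x0 x1 q :
  slow_weighted_force w x0 x1 q =
  \sum_(1 <= m < p) w m *: dV_s V (interp x0 x1 m) (q m)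
  + a *: (w 0%N *: dV_s V (interp x0 x1 0) (q 0%N))
  + (1 - a) *: (w p *: dV_s V (interp x0 x1 p) (q p)).
Proof.
exact: (sum_trapezoid a (fun m => w m *: dV_s V (interp x0 x1 m) (q m))).
Qed.

Section SlowGradient.
Context (x0 x1 : 'cV[R]_ns) (q : nat -> 'cV[R]_nf).
Hypothesis q_in : forall m, (m <= p)%N -> Qs (interp x0 x1 m) /\ Qf (q m).

(* Both slow arguments are treated at once: [I] and [X] are the interpolation
   and the macro increment as functions of the argument that varies. *)
Lemma grad_L_slow (I : nat -> 'cV[R]_ns -> 'cV[R]_ns)
    (X : 'cV[R]_ns -> 'cV[R]_ns) (w : nat -> R) (e : R) x :
  (forall (h : R) v, X (h *: v + x) = h *: (e *: v) + X x) ->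
  (forall m (h : R) v, I m (h *: v + x) = h *: (w m *: v) + I m x) ->
  X x = x1 - x0 -> (forall m, I m x = interp x0 x1 m) ->
  grad (fun z => \sum_(0 <= m < p)
     (dt / 2 * quad Ms (DT^-1 *: X z)
      + dt / 2 * quad Mf (dt^-1 *: (q m.+1 - q m))
      - dt * (a * V (I m z, q m) + (1 - a) * V (I m.+1 z, q m.+1))
      - dt * W (midpoint (q m) (q m.+1)))) x
  = (e / DT) *: (Ms *m (x1 - x0)) - dt *: slow_weighted_force w x0 x1 q.
Proof.
move=> XE IE Xx Ix.
have gV m : (m <= p)%N ->
    is_grad (fun z => V (I m z, q m)) x (w m *: dV_s V (interp x0 x1 m) (q m)).
  move=> mp; have [Qx Qy] := q_in mp.
  by rewrite -Ix; apply: is_grad_V_slow => //; rewrite Ix.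
have gT : is_grad (fun z => quad Ms (DT^-1 *: X z)) x
    ((2 * (DT^-1 * e)) *: (Ms *m (DT^-1 *: (x1 - x0)))).
  rewrite -Xx; apply: (is_grad_quad_affine (A := fun z => DT^-1 *: X z)) => //.
  by move=> h v; rewrite XE scalerDr !scalerA mulrCA.
(* The two zeros belong to the fast kinetic energy and to [W], constant in the slow argument. *)
rewrite (grad_is_grad (is_grad_sum (u := fun m =>
  (dt / 2) *: ((2 * (DT^-1 * e)) *: (Ms *m (DT^-1 *: (x1 - x0)))) + 0
  - dt *: (a *: (w m *: dV_s V (interp x0 x1 m) (q m))
    + (1 - a) *: (w m.+1 *: dV_s V (interp x0 x1 m.+1) (q m.+1))) - 0) _)).
  under eq_bigr do rewrite addr0 subr0.
  (* The [p] equal kinetic shares add up to the factor [e / DT], since [DT] is [p%:R * dt]. *)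
  rewrite sumrB sumr_const_nat subn0 -scaler_sumr -scaler_nat.
  congr (_ - _); rewrite -scalemxAr !scalerA; congr (_ *: _).
  by rewrite /macro_step; field; rewrite pR_neq0 dt_neq0.
move=> m mp; have mp' := ltnW mp.
apply: is_gradB; last exact: is_grad_cst.
apply: is_gradB.
  by apply: is_gradD; [exact: is_gradZ|exact: is_grad_cst].
by apply: is_gradZ; apply: is_gradD; apply: is_gradZ; exact: gV.
Qed.

(** The interpolation has slope [1 - m/p] in its left argument; this vanishes at node [p], so only
    the end point weighted by [a] survives. *)
Lemma grad_L_left :
  grad (fun x => L x x1 q) x0
  = - DT^-1 *: (Ms *m (x1 - x0))
    - dt *: (\sum_(1 <= m < p)
               ((p - m)%:R / p%:R) *: dV_s V (interp x0 x1 m) (q m)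
             + a *: dV_s V (interp x0 x1 0) (q 0%N)).
Proof.
under [fun x => L x _ _]eq_fun do rewrite L_d_sum /L_dm.
rewrite (grad_L_slow (I := fun m z => interp z x1 m) (X := fun z => x1 - z)
  (w := fun m => 1 - m%:R / p%:R) (e := -1)) //.
- rewrite mulN1r slow_weighted_forceE; congr (_ - _ *: _).
  rewrite divff ?pR_neq0 // subrr scale0r scaler0 addr0 mul0r subr0 scale1r.
  congr (_ + _); apply: eq_big_nat => m /andP[_ mp]; congr (_ *: _).
  by rewrite natrB ?(ltnW mp) // mulrBl divff ?pR_neq0.
- by move=> h v; apply/colP => i; rewrite !mxE; ring.
- by move=> m h v; apply/colP => i; rewrite !mxE; ring.
Qed.

(** Mirror image: the slope [m/p] vanishes at node 0, leaving the end point weighted by [1 - a]. *)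
Lemma grad_L_right :
  grad (fun x => L x0 x q) x1
  = DT^-1 *: (Ms *m (x1 - x0))
    - dt *: (\sum_(1 <= m < p)
               (m%:R / p%:R) *: dV_s V (interp x0 x1 m) (q m)
             + (1 - a) *: dV_s V (interp x0 x1 p) (q p)).
Proof.
under [fun x => L _ x _]eq_fun do rewrite L_d_sum /L_dm.
rewrite (grad_L_slow (I := fun m z => interp x0 z m) (X := fun z => z - x0)
  (w := fun m => m%:R / p%:R) (e := 1)) //.
- rewrite mul1r slow_weighted_forceE.
  by rewrite mul0r scale0r scaler0 addr0 divff ?pR_neq0 // scale1r.
- by move=> h v; apply/colP => i; rewrite !mxE; ring.
- by move=> m h v; apply/colP => i; rewrite !mxE; ring.
Qed.

End SlowGradient.

Section FastGradient.
Context (m : nat) (x0 x1 : 'cV[R]_ns) (y0 y1 : 'cV[R]_nf).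
Hypotheses (Qx0 : Qs (interp x0 x1 m)) (Qx1 : Qs (interp x0 x1 m.+1)).
Hypotheses (Qy0 : Qf y0) (Qy1 : Qf y1) (Qmid : Qf (midpoint y0 y1)).

Lemma grad_Lm_left :
  grad (fun y => Lm m x0 x1 y y1) y0
  = - dt^-1 *: (Mf *m (y1 - y0)) - (a * dt) *: dV_f V (interp x0 x1 m) y0
    - (dt / 2) *: grad W (midpoint y0 y1).
Proof.
have gT : is_grad (fun y => quad Mf (dt^-1 *: (y1 - y))) y0
    ((2 * - dt^-1) *: (Mf *m (dt^-1 *: (y1 - y0)))).
  apply: (is_grad_quad_affine (A := fun y => dt^-1 *: (y1 - y))) => //.
  by move=> h v; apply/colP => i; rewrite !mxE; ring.
have gV := is_grad_V_fast Qx0 Qy0.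
have gW : is_grad (fun y => W (midpoint y y1)) y0
    (2^-1 *: grad W (midpoint y0 y1)).
  apply: (is_grad_W (A := fun y => midpoint y y1)) => // h v.
  by apply/colP => i; rewrite !mxE; ring.
(* The zeros stand for the slow kinetic share and for [V] at the opposite node, both constant in
   [y]. *)
rewrite (grad_is_grad (u := 0 +
  (dt / 2) *: ((2 * - dt^-1) *: (Mf *m (dt^-1 *: (y1 - y0))))
  - dt *: (a *: dV_f V (interp x0 x1 m) y0 + (1 - a) *: 0)
  - dt *: (2^-1 *: grad W (midpoint y0 y1)))).
  rewrite add0r scaler0 addr0 -scalemxAr !scalerA [dt * a]mulrC.
  by congr (_ *: _ - _ - _); field; rewrite dt_neq0.
apply: is_gradB; last exact: is_gradZ.
apply: is_gradB.
  by apply: is_gradD; [exact: is_grad_cst|exact: is_gradZ].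
apply: is_gradZ; apply: is_gradD; apply: is_gradZ => //.
exact: is_grad_cst.
Qed.

Lemma grad_Lm_right :
  grad (fun y => Lm m x0 x1 y0 y) y1
  = dt^-1 *: (Mf *m (y1 - y0))
    - ((1 - a) * dt) *: dV_f V (interp x0 x1 m.+1) y1
    - (dt / 2) *: grad W (midpoint y0 y1).
Proof.
have gT : is_grad (fun y => quad Mf (dt^-1 *: (y - y0))) y1
    ((2 * dt^-1) *: (Mf *m (dt^-1 *: (y1 - y0)))).
  apply: (is_grad_quad_affine (A := fun y => dt^-1 *: (y - y0))) => //.
  by move=> h v; apply/colP => i; rewrite !mxE; ring.
have gV := is_grad_V_fast Qx1 Qy1.
have gW : is_grad (fun y => W (midpoint y0 y)) y1
    (2^-1 *: grad W (midpoint y0 y1)).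
  apply: (is_grad_W (A := fun y => midpoint y0 y)) => // h v.
  by apply/colP => i; rewrite !mxE; ring.
rewrite (grad_is_grad (u := 0 +
  (dt / 2) *: ((2 * dt^-1) *: (Mf *m (dt^-1 *: (y1 - y0))))
  - dt *: (a *: 0 + (1 - a) *: dV_f V (interp x0 x1 m.+1) y1)
  - dt *: (2^-1 *: grad W (midpoint y0 y1)))).
  rewrite add0r scaler0 add0r -scalemxAr !scalerA [dt * (1 - a)]mulrC.
  by congr (_ *: _ - _ - _); field; rewrite dt_neq0.
apply: is_gradB; last exact: is_gradZ.
apply: is_gradB.
  by apply: is_gradD; [exact: is_grad_cst|exact: is_gradZ].
apply: is_gradZ; apply: is_gradD; apply: is_gradZ => //.
exact: is_grad_cst.
Qed.

End FastGradient.

End DiscreteLagrangian.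

(** * From momentum equations to time steps *)

Lemma slow_momentum_step {R : realType} {n : nat} (M : 'M[R]_n) (c d : R)
    (x0 x1 P0 P1 A B : 'cV[R]_n) :
  M \in unitmx -> c != 0 ->
  (P0 = - (- c^-1 *: (M *m (x1 - x0)) - d *: A)
   /\ P1 = c^-1 *: (M *m (x1 - x0)) - d *: B)
  <-> (x1 = x0 + c *: (invmx M *m (P0 - d *: A)) /\ P1 = P0 - d *: (A + B)).
Proof.
move=> unitM c0; rewrite -legendre_step // scaleNr opprD !opprK.
(* The system now reads [P0 = K + d *: A], [P1 = K - d *: B], and [K] can be eliminated. *)
set K := c^-1 *: _; rewrite scalerDr opprD addrA.
split=> [[-> ->]|[E ->]]; first by rewrite addrK.
by rewrite -E subrK.
Qed.

(** The average of [Pt] and [Ph] is [Pt] minus half the kick [d *: G], which is exactly the momentum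
    carried by the increment. *)
Lemma fast_momentum_step {R : realType} {n : nat} (M : 'M[R]_n) (d a : R)
    (y0 y1 P0 P1 F0 F1 G : 'cV[R]_n) :
  M \in unitmx -> d != 0 ->
  let Pt := P0 - (a * d) *: F0 in
  let Ph := Pt - d *: G in
  (P0 = - (- d^-1 *: (M *m (y1 - y0)) - (a * d) *: F0 - (d / 2) *: G)
   /\ P1 = d^-1 *: (M *m (y1 - y0)) - ((1 - a) * d) *: F1 - (d / 2) *: G)
  <-> (y1 = y0 + d *: (invmx M *m (2^-1 *: (Pt + Ph)))
       /\ P1 = Ph - ((1 - a) * d) *: F1).
Proof.
move=> unitM d0 Pt Ph; rewrite -legendre_step //.
rewrite scaleNr; set K := d^-1 *: _.
have -> : 2^-1 *: (Pt + Ph) = P0 - (a * d) *: F0 - (d / 2) *: G.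
  by apply/colP => i; rewrite !mxE; field.
have -> : (P0 = - (- K - (a * d) *: F0 - (d / 2) *: G))
        = (P0 - (a * d) *: F0 - (d / 2) *: G = K).
  by rewrite propeqE; split=> [->|<-]; apply/colP => i; rewrite !mxE; ring.
(* The half kicks of the left and right equations combine into the full kick in [Ph]. *)
by split=> -[<- ->]; split=> //; apply/colP => i; rewrite !mxE; field.
Qed.

Theorem theorem3p4 (R : realType) (ns nf : nat)
  (Qs : set 'cV[R]_ns) (Qf : set 'cV[R]_nf)
  (Ms : 'M[R]_ns) (Mf : 'M[R]_nf)
  (V : 'cV[R]_ns * 'cV[R]_nf -> R) (W : 'cV[R]_nf -> R)
  (p N : nat) (dt alphaV : R)
  (qs : nat -> 'cV[R]_ns) (qf : nat -> nat -> 'cV[R]_nf)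
  (ps : nat -> 'cV[R]_ns) (pf : nat -> nat -> 'cV[R]_nf)
  (open_Qs : open Qs) (open_Qf : open Qf)
  (sym_Ms : Ms^T = Ms) (inv_Ms : Ms \in unitmx)
  (sym_Mf : Mf^T = Mf) (inv_Mf : Mf \in unitmx)
  (smooth_V : smooth_on (Qs `*` Qf) V) (smooth_W : smooth_on Qf W)
  (p_gt0 : (0 < p)%N) (dt_gt0 : 0 < dt) (alphaV01 : 0 <= alphaV <= 1)
  (q_in : nodes_in p Qs Qf N qs qf)
  (qf_glued : glued p N qf) (pf_glued : glued p N pf) :
  (momentum_form p dt alphaV Ms Mf V W N qs qf ps pf
     <-> pq_scheme p dt alphaV Ms Mf V W N qs qf ps pf)
  /\ (pq_scheme p dt alphaV Ms Mf V W N qs qf ps pf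
     <-> transformed_pq_scheme p dt alphaV Ms Mf V W N qs qf ps pf).
Proof.
have dt0 : dt != 0 := dt_neq0 dt_gt0.
have DT0 := macro_step_neq0 p_gt0 dt_gt0.
have slowE k : (k < N)%N ->
  let qsm := slow_interp p (qs k) (qs k.+1) in
  let A := \sum_(1 <= m < p) ((p - m)%:R / p%:R) *: dV_s V (qsm m) (qf k m)
           + alphaV *: dV_s V (qsm 0%N) (qf k 0%N) in
  let B := \sum_(1 <= m < p) (m%:R / p%:R) *: dV_s V (qsm m) (qf k m)
           + (1 - alphaV) *: dV_s V (qsm p) (qf k p) in
  \sum_(1 <= m < p) dV_s V (qsm m) (qf k m)
    + alphaV *: dV_s V (qsm 0%N) (qf k 0%N)
    + (1 - alphaV) *: dV_s V (qsm p) (qf k p) = A + B.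
  by move=> kN /=; rewrite -sum_complementary_weights addrACA !addrA.
(* The second equivalence is settled first: it only introduces or eliminates the intermediate
   momentum [pst], via [A + B]. *)
split; last first.
  split=> -[slow fast]; split=> //.
    exists (fun k => ps k - dt *: (\sum_(1 <= m < p)
        ((p - m)%:R / p%:R) *: dV_s V (slow_interp p (qs k) (qs k.+1) m) (qf k m)
      + alphaV *: dV_s V (slow_interp p (qs k) (qs k.+1) 0) (qf k 0%N))) => k kN.
    have [qE pE] := slow k kN.
    by split=> //; rewrite [LHS]pE slowE // scalerDr opprD addrA.
  case: slow => pst slow k kN; have [tE qE pE] := slow k kN.
  by rewrite /= slowE // -tE; split=> //; rewrite scalerDr opprD addrA -tE.
have slow_iff k :=
  slow_momentum_step dt (qs k) (qs k.+1) (ps k) (ps k.+1)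
    (\sum_(1 <= m < p) ((p - m)%:R / p%:R)
         *: dV_s V (slow_interp p (qs k) (qs k.+1) m) (qf k m)
       + alphaV *: dV_s V (slow_interp p (qs k) (qs k.+1) 0) (qf k 0%N))
    (\sum_(1 <= m < p) (m%:R / p%:R)
         *: dV_s V (slow_interp p (qs k) (qs k.+1) m) (qf k m)
       + (1 - alphaV) *: dV_s V (slow_interp p (qs k) (qs k.+1) p) (qf k p))
    inv_Ms DT0.
have fast_iff k m :=
  fast_momentum_step alphaV (qf k m) (qf k m.+1) (pf k m) (pf k m.+1)
    (dV_f V (slow_interp p (qs k) (qs k.+1) m) (qf k m))
    (dV_f V (slow_interp p (qs k) (qs k.+1) m.+1) (qf k m.+1))
    (grad W (midpoint (qf k m) (qf k m.+1))) inv_Mf dt0.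
have slow_grads k (kN : (k < N)%N) :=
  (grad_L_left Mf W alphaV sym_Ms smooth_V p_gt0 dt_gt0 (q_in k kN).1,
   grad_L_right Mf W alphaV sym_Ms smooth_V p_gt0 dt_gt0 (q_in k kN).1).
have fast_grads k m (kN : (k < N)%N) (mp : (m < p)%N) :=
  let: conj Qn Qm := q_in k kN in
  let: conj Qx0 Qy0 := Qn m (ltnW mp) in
  let: conj Qx1 Qy1 := Qn m.+1 mp in
  (grad_Lm_left Ms alphaV sym_Mf smooth_V smooth_W dt_gt0 Qx0 Qy0 (Qm m mp),
   grad_Lm_right Ms alphaV sym_Mf smooth_V smooth_W dt_gt0 Qx1 Qy1 (Qm m mp)).
split=> [mom|[slow [pft [pfh fast]]] k kN].
  split=> [k kN /=|].
    have [p0E p1E _] := mom k kN; rewrite !slow_grads // in p0E p1E.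
    by rewrite slowE //; exact: (slow_iff k).1 (conj p0E p1E).
  pose pft k m := pf k m
    - (alphaV * dt) *: dV_f V (slow_interp p (qs k) (qs k.+1) m) (qf k m).
  (* The hat momentum is indexed by the right node of its interval, hence the predecessors;
     [fast_part] never reads index 0. *)
  exists pft, (fun k m => pft k m.-1
    - dt *: grad W (midpoint (qf k m.-1) (qf k m))) => k m kN mp /=.
  have [_ _ /(_ m mp)[p0E p1E]] := mom k kN.
  rewrite !(fast_grads k m kN mp) in p0E p1E.
  by have [] := (fast_iff k m).1 (conj p0E p1E).
have [qE pE] := slow k kN; rewrite slowE // in pE.
have [p0E p1E] := (slow_iff k).2 (conj qE pE).
split=> [||m mp]; rewrite ?slow_grads //.
have [tE yE hE p1'E] := fast k m kN mp.
rewrite !(fast_grads k m kN mp); apply/(fast_iff k m).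
(* Their own equations force the given [pft] and [pfh] to be the [Pt] and [Ph] of
   [fast_momentum_step]. *)
by rewrite -tE -hE.
Qed.
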